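(* For any smooth field $\xi=(\xi_x,\xi_v)\in\mathbb R^6$ (a function of $(x,v)\in\mathbb R^3\times\mathbb R^3$), $$\langle\mathrm{div}_{x,v}\xi\rangle=\mathrm{div}_{\bar x}\Big\{\Big\langle\xi_{\bar x}+\frac{{}^\perp\xi_{\bar v}}{\omega_c}\Big\rangle+\Big\langle\xi_{\bar v}\cdot\frac{{}^\perp\bar v}{|\bar v|}\Big\rangle\frac{\bar v}{\omega_c|\bar v|}-\Big\langle\xi_{\bar v}\cdot\frac{\bar v}{|\bar v|}\Big\rangle\frac{{}^\perp\bar v}{\omega_c|\bar v|}\Big\}+\partial_{x_3}\langle\xi_{x_3}\rangle$$ $$+\,\mathrm{div}_{\bar v}\Big\{\Big\langle\xi_{\bar v}\cdot\frac{{}^\perp\bar v}{|\bar v|}\Big\rangle\frac{{}^\perp\bar v}{|\bar v|}+\Big\langle\xi_{\bar v}\cdot\frac{\bar v}{|\bar v|}\Big\rangle\frac{\bar v}{|\bar v|}\Big\}+\partial_{v_3}\langle\xi_{v_3}\rangle.$$ In particular, for any smooth field $\xi_x\in\mathbb R^3$, $\langle\mathrm{div}_x\xi_x\rangle=\mathrm{div}_x\langle\xi_x\rangle$, and for any smooth field $\xi_v\in\mathbb R^3$, $$\langle\mathrm{div}_v\xi_v\rangle=\mathrm{div}_{\bar x}\Big\{\Big\langle\frac{{}^\perp\xi_{\bar v}}{\omega_c}\Big\rangle+\Big\langle\xi_{\bar v}\cdot\frac{{}^\perp\bar v}{|\bar v|}\Big\rangle\frac{\bar v}{\omega_c|\bar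 v|}-\Big\langle\xi_{\bar v}\cdot\frac{\bar v}{|\bar v|}\Big\rangle\frac{{}^\perp\bar v}{\omega_c|\bar v|}\Big\}+\mathrm{div}_{\bar v}\Big\{\Big\langle\xi_{\bar v}\cdot\frac{{}^\perp\bar v}{|\bar v|}\Big\rangle\frac{{}^\perp\bar v}{|\bar v|}+\Big\langle\xi_{\bar v}\cdot\frac{\bar v}{|\bar v|}\Big\rangle\frac{\bar v}{|\bar v|}\Big\}+\partial_{v_3}\langle\xi_{v_3}\rangle.$$
   Context: Notation. $x=(x_1,x_2,x_3)$, $v=(v_1,v_2,v_3)\in\mathbb R^3$, $\bar x=(x_1,x_2)$, $\bar v=(v_1,v_2)$; for $w=(w_1,w_2)\in\mathbb R^2$, ${}^\perp w=(w_2,-w_1)$. $\omega_c\ne0$ is a real constant. For $\xi=(\xi_x,\xi_v)$: $\xi_x=(\xi_{x_1},\xi_{x_2},\xi_{x_3})$, $\xi_{\bar x}=(\xi_{x_1},\xi_{x_2})$, $\xi_v=(\xi_{v_1},\xi_{v_2},\xi_{v_3})$, $\xi_{\bar v}=(\xi_{v_1},\xi_{v_2})$. Average operator: for a function $u(x,v)$, $$\langle u\rangle(x,v)=\frac1{2\pi}\int_0^{2\pi}u\Big(\bar x+\frac{{}^\perp\bar v}{\omega_c}-\frac{{}^\perp\{|\bar v|e^{i\alpha}\}}{\omega_c},x_3,|\bar v|e^{i\alpha},v_3\Big)d\alpha,\quad e^{i\alpha}=(\cos\alpha,\sin\alpha),$$ applied componentwise to vector fields. Expressions involving $1/|\bar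 v|$ are considered for $\bar v\neq0$. *)

(* Defs.v *)
From Stdlib Require Import Reals.
From Coquelicot Require Import Coquelicot.
Open Scope R_scope.

Notation R2 := (R * R)%type.
Notation R3 := (R * R * R)%type.

(* Points (x, v), with x = ((x1, x2), x3) and v = ((v1, v2), v3). *)
Notation phase := (R3 * R3)%type.

Definition bar (w : R3) : R2 := fst w.
Definition third (w : R3) : R := snd w.

Definition perp (w : R2) : R2 := (snd w, - fst w).
Definition dot2 (a b : R2) : R := fst a * fst b + snd a * snd b.
Definition norm2 (w : R2) : R := sqrt (fst w ^ 2 + snd w ^ 2).

Inductive coord : Set := X1 | X2 | X3 | V1 | V2 | V3.

Definition get (i : coord) (p : phase) : R :=
  let '((x1, x2, x3), (v1, v2, v3)) := p in
  match i with
  | X1 => x1 | X2 => x2 | X3 => x3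
  | V1 => v1 | V2 => v2 | V3 => v3
  end.

Definition set (i : coord) (s : R) (p : phase) : phase :=
  let '((x1, x2, x3), (v1, v2, v3)) := p in
  match i with
  | X1 => ((s, x2, x3), (v1, v2, v3))
  | X2 => ((x1, s, x3), (v1, v2, v3))
  | X3 => ((x1, x2, s), (v1, v2, v3))
  | V1 => ((x1, x2, x3), (s, v2, v3))
  | V2 => ((x1, x2, x3), (v1, s, v3))
  | V3 => ((x1, x2, x3), (v1, v2, s))
  end.

Definition partial (i : coord) (u : phase -> R) (p : phase) : R :=
  Derive (fun s => u (set i s p)) (get i p).

(* [partial] is a total function: this says that its value is meaningful. *)
Definition ex_partial (i : coord) (u : phase -> R) (p : phase) : Prop :=
  ex_derive (fun s => u (set i s p)) (get i p).

Fixpoint Ck (k : nat) (u : phase -> R) : Prop :=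
  match k with
  | O => forall p, continuous u p
  | S k' => forall i, (forall p, ex_partial i u p) /\ Ck k' (partial i u)
  end.

Definition smooth (u : phase -> R) : Prop := forall k, Ck k u.

Definition smooth3 (F : phase -> R3) : Prop :=
  smooth (fun q => fst (fst (F q))) /\
  smooth (fun q => snd (fst (F q))) /\
  smooth (fun q => snd (F q)).

Definition smooth6 (xi : phase -> R3 * R3) : Prop :=
  smooth3 (fun q => fst (xi q)) /\ smooth3 (fun q => snd (xi q)).

Definition div_xbar (F : phase -> R2) (p : phase) : R :=
  partial X1 (fun q => fst (F q)) p + partial X2 (fun q => snd (F q)) p.

Definition div_vbar (F : phase -> R2) (p : phase) : R :=
  partial V1 (fun q => fst (F q)) p + partial V2 (fun q => snd (F q)) p.

Definition div_x (F : phase -> R3) (p : phase) : R :=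
  partial X1 (fun q => fst (fst (F q))) p
  + partial X2 (fun q => snd (fst (F q))) p
  + partial X3 (fun q => snd (F q)) p.

Definition div_v (F : phase -> R3) (p : phase) : R :=
  partial V1 (fun q => fst (fst (F q))) p
  + partial V2 (fun q => snd (fst (F q))) p
  + partial V3 (fun q => snd (F q)) p.

Definition div_xv (xi : phase -> R3 * R3) (p : phase) : R :=
  div_x (fun q => fst (xi q)) p + div_v (fun q => snd (xi q)) p.

Definition ex_div_xbar (F : phase -> R2) (p : phase) : Prop :=
  ex_partial X1 (fun q => fst (F q)) p /\ ex_partial X2 (fun q => snd (F q)) p.

Definition ex_div_vbar (F : phase -> R2) (p : phase) : Prop :=
  ex_partial V1 (fun q => fst (F q)) p /\ ex_partial V2 (fun q => snd (F q)) p.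

Definition ex_div_x (F : phase -> R3) (p : phase) : Prop :=
  ex_partial X1 (fun q => fst (fst (F q))) p /\
  ex_partial X2 (fun q => snd (fst (F q))) p /\
  ex_partial X3 (fun q => snd (F q)) p.

Definition circle (r alpha : R) : R2 := (r * cos alpha, r * sin alpha).

Definition gyro (omega alpha : R) (p : phase) : phase :=
  let '(x, v) := p in
  let w := circle (norm2 (bar v)) alpha in
  ((minus (plus (bar x) (scal (/ omega) (perp (bar v))))
          (scal (/ omega) (perp w)),
    third x),
   (w, third v)).

Definition avg (omega : R) (u : phase -> R) (p : phase) : R :=
  / (2 * PI) * RInt (fun alpha => u (gyro omega alpha p)) 0 (2 * PI).

Definition avg2 (omega : R) (F : phase -> R2) (p : phase) : R2 :=
  (avg omega (fun q => fst (F q)) p, avg omega (fun q => snd (F q)) p).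

Definition avg3 (omega : R) (F : phase -> R3) (p : phase) : R3 :=
  (avg omega (fun q => fst (fst (F q))) p,
   avg omega (fun q => snd (fst (F q))) p,
   avg omega (fun q => snd (F q)) p).

(* The unit vectors along the planar velocity and along its [perp]; they are
   only meaningful where the planar velocity does not vanish. *)
Definition e_par (q : phase) : R2 :=
  scal (/ norm2 (bar (snd q))) (bar (snd q)).

Definition e_perp (q : phase) : R2 :=
  scal (/ norm2 (bar (snd q))) (perp (bar (snd q))).

(* The fields under the planar divergences in x and v.  [G] is the averaged
   planar field specific to each formula, [W] the planar velocity component. *)
Definition flux_xbar (omega : R) (G W : phase -> R2) (q : phase) : R2 :=
  minus
    (plus (avg2 omega G q)
       (scal (avg omega (fun q' => dot2 (W q') (e_perp q')) q)
             (scal (/ omega) (e_par q))))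
    (scal (avg omega (fun q' => dot2 (W q') (e_par q')) q)
          (scal (/ omega) (e_perp q))).

Definition flux_vbar (omega : R) (W : phase -> R2) (q : phase) : R2 :=
  plus
    (scal (avg omega (fun q' => dot2 (W q') (e_perp q')) q) (e_perp q))
    (scal (avg omega (fun q' => dot2 (W q') (e_par q')) q) (e_par q)).

(* Main.v *)
Require Import Defs.
From Stdlib Require Import Reals Lra FunctionalExtensionality.
From Coquelicot Require Import Coquelicot.
Open Scope R_scope.

(** The average of [u] at [p] depends on [p] only through the guiding center
    c = xbar + perp(vbar) / omega, the radius r = |vbar|, x3 and v3; it is the mean
    of [u] over the circle with these parameters.  Differentiating under the
    integral ([is_derive_gyromean]) expresses every derivative of an average as
    the mean of a directional derivative of [u] along the velocity ([drift]) of
    the points of that circle.  Derivatives in x and v3 translate the circle and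
    therefore commute with the average, which settles the identity for fields
    in x and leaves only the planar velocity part W of the field.

    At angle a on the circle the frame is e_par = (cos a, sin a), so that the
    means A and B of W along e_par and e_perp are averages of the Cartesian
    components of W with weights cos a and sin a.  Computing the divergences of
    B e_perp + A e_par in v and of (B e_par - A e_perp) / omega in x, the derivatives
    in c cancel against each other, because moving vbar moves c by the rotated
    displacement over omega, and what remains is dA/dr + A/r, as in polar
    coordinates.  Here dA/dr is the mean of a radial derivative, and an
    integration by parts over the angle ([is_mean_spin]) turns A/r into the mean
    of an angular derivative of W.  Both involve x-derivatives, since the
    position on the circle depends on r and a as well.  In Cartesian terms their
    sum is the mean of the planar divergence of W in v and of
    (d W1/dx2 - d W2/dx1) / omega ([is_mean_polar_divergence], [flux_divergence]).
    The latter is minus the divergence in x of perp(W) / omega, which is exactly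
    the correction added to the x-component of the field ([avg_div_xv]). *)

(** * Smooth functions and the chain rule *)

Lemma smooth_continuous u p : smooth u -> continuous u p.
Proof. intros H; exact (H 0%nat p). Qed.

Lemma smooth_ex_partial i u p : smooth u -> ex_partial i u p.
Proof. intros H; exact (proj1 (H 1%nat i) p). Qed.

Lemma smooth_partial i u : smooth u -> smooth (partial i u).
Proof. intros H k; exact (proj2 (H (S k) i)). Qed.

Lemma set_get i p : set i (get i p) p = p.
Proof. destruct p as [[[x1 x2] x3] [[v1 v2] v3]]; now destruct i. Qed.

Lemma partial_unique i (f : phase -> R) p l :
  is_derive (fun s => f (set i s p)) (get i p) l -> partial i f p = l.
Proof. apply is_derive_unique. Qed.

Lemma is_derive_partial i u p s : smooth u ->
  is_derive (fun s' => u (set i s' p)) s (partial i u (set i s p)).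
Proof.
  intros H. generalize (smooth_ex_partial i u (set i s p) H).
  unfold ex_partial, partial.
  destruct p as [[[x1 x2] x3] [[v1 v2] v3]]; destruct i; exact (Derive_correct _ _).
Qed.

Lemma partial_lin i u v a b : smooth u -> smooth v ->
  partial i (fun q => a * u q + b * v q) = fun q => a * partial i u q + b * partial i v q.
Proof.
  intros Hu Hv. extensionality q. unfold partial.
  rewrite Derive_plus by (apply ex_derive_scal; now apply smooth_ex_partial).
  now rewrite !Derive_scal.
Qed.

Lemma smooth_lin u v a b : smooth u -> smooth v -> smooth (fun q => a * u q + b * v q).
Proof.
  intros Hu Hv k. revert u v Hu Hv.
  induction k as [|k IH]; intros u v Hu Hv.
  - intros p. apply (continuous_plus (fun q => a * u q) (fun q => b * v q)).
    + apply (continuous_scal_r a u). now apply smooth_continuous.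
    + apply (continuous_scal_r b v). now apply smooth_continuous.
  - intros i. split.
    + intros p. apply (ex_derive_plus (fun s => a * u (set i s p)) (fun s => b * v (set i s p)));
        apply ex_derive_scal; now apply smooth_ex_partial.
    + rewrite (partial_lin i u v a b Hu Hv). apply IH; now apply smooth_partial.
Qed.

Lemma smooth_plus u v : smooth u -> smooth v -> smooth (fun q => u q + v q).
Proof.
  intros Hu Hv.
  replace (fun q => u q + v q) with (fun q => 1 * u q + 1 * v q).
  - now apply smooth_lin.
  - extensionality q; ring.
Qed.

Lemma partial_const i c : partial i (fun _ => c) = fun _ => 0.
Proof. extensionality p. apply (Derive_const c). Qed.

Lemma smooth_const (c : R) : smooth (fun _ => c).
Proof.
  intros k. revert c. induction k as [|k IH]; intros c.
  - intros p. apply continuous_const.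
  - intros i. split.
    + intros p. exists 0. apply (is_derive_const c).
    + rewrite partial_const. apply IH.
Qed.

Lemma is_derive_continuous (f : R -> R) (t l : R) : is_derive f t l -> continuous f t.
Proof. intros H. apply (ex_derive_continuous f). now exists l. Qed.

Lemma is_derive_Rmult (f g : R -> R) t df dg : is_derive f t df -> is_derive g t dg ->
  is_derive (fun s => f s * g s) t (df * g t + f t * dg).
Proof. intros Hf Hg. apply (is_derive_mult f g); trivial. intros; apply Rmult_comm. Qed.

Definition of_coords (h : coord -> R) : phase :=
  ((h X1, h X2, h X3), (h V1, h V2, h V3)).

Definition gradient_dot (d : coord -> R) (u : phase -> R) (p : phase) : R :=
  d X1 * partial X1 u p + d X2 * partial X2 u p + d X3 * partial X3 u p
  + d V1 * partial V1 u p + d V2 * partial V2 u p + d V3 * partial V3 u p.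

Lemma continuous_pair {T U V : UniformSpace} (f : T -> U) (g : T -> V) t :
  continuous f t -> continuous g t -> continuous (fun s => (f s, g s)) t.
Proof.
  intros Hf Hg P [eps HP].
  assert (Ef := Hf _ (locally_ball (f t) eps)).
  assert (Eg := Hg _ (locally_ball (g t) eps)).
  unfold filtermap in *. generalize (filter_and _ _ Ef Eg). apply filter_imp.
  intros s [H1 H2]. apply HP. now split.
Qed.

Lemma continuous_of_coords {T : UniformSpace} (h : T -> coord -> R) t :
  (forall i, continuous (fun s => h s i) t) -> continuous (fun s => of_coords (h s)) t.
Proof.
  intros H. unfold of_coords. repeat apply continuous_pair; apply H.
Qed.

Definition coord_eq_dec (i j : coord) : {i = j} + {i <> j}.
Proof. decide equality. Defined.

Definition update (i : coord) (x : R) (c : coord -> R) (j : coord) : R :=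
  if coord_eq_dec i j then x else c j.

Lemma set_of_coords i x c : set i x (of_coords c) = of_coords (update i x c).
Proof. now destruct i. Qed.

Lemma continuous_gradient_dot {T : UniformSpace} u (d h : T -> coord -> R) t :
  smooth u -> (forall i, continuous (fun s => d s i) t) ->
  (forall i, continuous (fun s => h s i) t) ->
  continuous (fun s => gradient_dot (d s) u (of_coords (h s))) t.
Proof.
  intros Hu Hd Hh.
  assert (H : forall i, continuous (fun s => d s i * partial i u (of_coords (h s))) t).
  { intros i. apply (continuous_mult (fun s => d s i)); [apply Hd|].
    apply (continuous_comp (fun s => of_coords (h s)) (partial i u)).
    - now apply continuous_of_coords.
    - now apply smooth_continuous, smooth_partial. }
  unfold gradient_dot.
  repeat (match goal with |- continuous (fun x => @?f x + @?g x) _ =>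
            apply (continuous_plus f g) end); apply H.
Qed.

(** One coordinate at a time, the chain rule needs only the mean value theorem:
    if the partial derivative in the moving coordinate [g] is continuous, the
    motion of [g] and that of the other coordinates contribute additively.  The
    hypothesis on [l] is the derivative with [g] frozen, so that the lemma can
    be iterated over the coordinates. *)
Lemma is_derive_set i u (g : R -> R) (h : R -> coord -> R) t dg l :
  smooth u -> is_derive g t dg -> (forall j, continuous (fun s => h s j) t) ->
  is_derive (fun s => u (set i (g t) (of_coords (h s)))) t l ->
  is_derive (fun s => u (set i (g s) (of_coords (h s)))) t
    (dg * partial i u (set i (g t) (of_coords (h t))) + l).
Proof.
  intros Hu Hg Hh Hl.
  set (D := partial i u (set i (g t) (of_coords (h t)))).
  assert (Hf : filterdiff (fun s => u (set i (g s) (of_coords (h s)))) (locally t)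
     (fun y => plus (scal (scal y dg) D) (scal y l))).
  { apply (filterdiff_comp'_2 g (fun s => s) (fun x y => u (set i x (of_coords (h y)))) t
      (fun y => scal y dg) (fun y => y) (fun a b => plus (scal a D) (scal b l))).
    - exact Hg.
    - apply filterdiff_id.
    - apply (is_derive_filterdiff (fun x y => u (set i x (of_coords (h y)))) (g t) t
        (fun x y => partial i u (set i x (of_coords (h y)))) l).
      + apply filter_forall. intros z. now apply is_derive_partial.
      + exact Hl.
      + apply (continuous_comp (fun z : R * R => set i (fst z) (of_coords (h (snd z)))) (partial i u));
          [|now apply smooth_continuous, smooth_partial].
        apply continuous_ext with
          (fun z : R * R => of_coords (update i (fst z) (h (snd z)))).
        { intros z. symmetry. apply set_of_coords. }
        apply (continuous_of_coords (fun z : R * R => update i (fst z) (h (snd z)))).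
        intros j. unfold update. destruct (coord_eq_dec i j).
        * apply continuous_fst.
        * apply (continuous_comp snd (fun s => h s j)); [apply continuous_snd | apply Hh]. }
  unfold is_derive.
  eapply filterdiff_ext_lin; [exact Hf|].
  intros y. unfold plus, scal; simpl. unfold mult; simpl. ring.
Qed.

(** The chain rule: iterating [is_derive_set] releases the six coordinates
    successively, starting from the constant curve.  Smoothness is given through
    partial derivatives only, hence the detour. *)
Lemma is_derive_along u (h : R -> coord -> R) (dh : coord -> R) t :
  smooth u -> (forall i, is_derive (fun s => h s i) t (dh i)) ->
  is_derive (fun s => u (of_coords (h s))) t (gradient_dot dh u (of_coords (h t))).
Proof.
  intros Hu Hh.
  assert (step : forall i (c : R -> coord -> R) l,
    (forall j, continuous (fun s => c s j) t) -> c t = h t ->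
    is_derive (fun s => u (of_coords (update i (h t i) (c s)))) t l ->
    is_derive (fun s => u (of_coords (update i (h s i) (c s)))) t
      (dh i * partial i u (of_coords (h t)) + l)).
  { intros i c l Hc Ec Hl.
    replace (of_coords (h t)) with (set i (h t i) (of_coords (c t))).
    2:{ rewrite Ec. now destruct i. }
    apply (is_derive_ext (fun s => u (set i (h s i) (of_coords (c s))))).
    { intros s. now rewrite set_of_coords. }
    apply (is_derive_set i u (fun s => h s i)); trivial.
    apply (is_derive_ext (fun s => u (of_coords (update i (h t i) (c s))))); trivial.
    intros s. now rewrite set_of_coords. }
  assert (Cc : forall j, continuous (fun s => h s j) t).
  { intros j. exact (is_derive_continuous _ _ _ (Hh j)). }
  (* Hybrid points, with the coordinates selected by [k] on the curve and the
     others frozen at time [t]: [k] grows from empty to everything, one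
     coordinate per step, and consecutive hybrids are related by [step]. *)
  pose (hyb := fun (k : coord -> bool) s j => if k j then h s j else h t j).
  assert (Chyb : forall k j, continuous (fun s => hyb k s j) t).
  { intros k j. unfold hyb. destruct (k j); [apply Cc | apply continuous_const]. }
  assert (Ehyb : forall k, hyb k t = h t).
  { intros k. extensionality j. unfold hyb. now destruct (k j). }
  assert (H0 : is_derive (fun s => u (of_coords (hyb (fun _ => false) s))) t 0)
    by exact (is_derive_const (u (of_coords (h t))) t).
  assert (H1 := step X1 _ _ (Chyb (fun _ => false)) (Ehyb _) H0).
  assert (H2 := step X2 _ _
    (Chyb (fun j => match j with X1 => true | _ => false end)) (Ehyb _) H1).
  assert (H3 := step X3 _ _
    (Chyb (fun j => match j with X1 | X2 => true | _ => false end)) (Ehyb _) H2).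
  assert (H4 := step V1 _ _
    (Chyb (fun j => match j with X1 | X2 | X3 => true | _ => false end)) (Ehyb _) H3).
  assert (H5 := step V2 _ _
    (Chyb (fun j => match j with X1 | X2 | X3 | V1 => true | _ => false end)) (Ehyb _) H4).
  assert (H6 := step V3 _ _
    (Chyb (fun j => match j with V3 => false | _ => true end)) (Ehyb _) H5).
  replace (gradient_dot _ _ _) with
   (dh V3 * partial V3 u (of_coords (h t)) + (dh V2 * partial V2 u (of_coords (h t)) +
    (dh V1 * partial V1 u (of_coords (h t)) + (dh X3 * partial X3 u (of_coords (h t)) +
    (dh X2 * partial X2 u (of_coords (h t)) + (dh X1 * partial X1 u (of_coords (h t)) + 0))))))
   by (unfold gradient_dot; ring).
  exact H6.
Qed.

(** * Gyration circles and differentiation under the average *)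

(** The gyration circle with guiding center [(c1, c2)] and radius [r].  In these
    parameters it is smooth, also at [r = 0], whereas [gyro] contains the square
    root [norm2]; and it is linear in [(c1, c2, z, r, k)], so that the velocity
    of a moving orbit point is again of the form [orbit]. *)
Definition orbit (omega c1 c2 z r k alpha : R) (i : coord) : R :=
  match i with
  | X1 => c1 - / omega * (r * sin alpha)
  | X2 => c2 + / omega * (r * cos alpha)
  | X3 => z
  | V1 => r * cos alpha
  | V2 => r * sin alpha
  | V3 => k
  end.

Lemma gyro_orbit omega alpha x1 x2 x3 v1 v2 v3 :
  gyro omega alpha ((x1, x2, x3), (v1, v2, v3)) =
  of_coords (orbit omega (x1 + / omega * v2) (x2 - / omega * v1) x3 (norm2 (v1, v2)) v3 alpha).
Proof.
  unfold gyro, of_coords, orbit, circle, perp, bar, third, minus, plus, opp, scal; simpl.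
  unfold prod_plus, prod_opp, prod_scal, plus, opp, scal; simpl; unfold mult; simpl.
  match goal with |- ((?a, ?b, ?c), ?d) = ((?a', ?b', ?c), ?d) =>
    replace a' with a by ring; replace b' with b by ring end.
  reflexivity.
Qed.

Lemma continuous_orbit {T : UniformSpace} omega (c1 c2 z r k a : T -> R) t i :
  continuous c1 t -> continuous c2 t -> continuous z t -> continuous r t ->
  continuous k t -> continuous a t ->
  continuous (fun s => orbit omega (c1 s) (c2 s) (z s) (r s) (k s) (a s) i) t.
Proof.
  intros H1 H2 H3 H4 H5 H6.
  assert (Hs : continuous (fun s => r s * sin (a s)) t).
  { apply (continuous_mult r (fun s => sin (a s))); trivial.
    apply (continuous_comp a sin); trivial. apply continuous_sin. }
  assert (Hc : continuous (fun s => r s * cos (a s)) t).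
  { apply (continuous_mult r (fun s => cos (a s))); trivial.
    apply (continuous_comp a cos); trivial. apply continuous_cos. }
  destruct i; simpl; trivial.
  - apply (continuous_minus c1 (fun s => / omega * (r s * sin (a s)))); trivial.
    now apply (continuous_scal_r (/ omega) (fun s => r s * sin (a s))).
  - apply (continuous_plus c2 (fun s => / omega * (r s * cos (a s)))); trivial.
    now apply (continuous_scal_r (/ omega) (fun s => r s * cos (a s))).
Qed.

Lemma is_derive_orbit omega (c1 c2 z r k : R -> R) dc1 dc2 dz dr dk alpha t i :
  is_derive c1 t dc1 -> is_derive c2 t dc2 -> is_derive z t dz -> is_derive r t dr ->
  is_derive k t dk ->
  is_derive (fun s => orbit omega (c1 s) (c2 s) (z s) (r s) (k s) alpha i) t
    (orbit omega dc1 dc2 dz dr dk alpha i).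
Proof.
  intros H1 H2 H3 H4 H5.
  assert (E1 := is_derive_unique (fun x : R => c1 x) t dc1 H1).
  assert (E2 := is_derive_unique (fun x : R => c2 x) t dc2 H2).
  assert (E4 := is_derive_unique (fun x : R => r x) t dr H4).
  destruct i; simpl; trivial; auto_derive;
    try (repeat split; eexists; eassumption);
    first [rewrite E1, E4 | rewrite E2, E4 | rewrite E4]; ring.
Qed.

Lemma is_derive_orbit_angle omega c1 c2 z r k alpha i :
  is_derive (fun a => orbit omega c1 c2 z r k a i) alpha
   (r * match i with
    | X1 => - / omega * cos alpha
    | X2 => - / omega * sin alpha
    | V1 => - sin alpha
    | V2 => cos alpha
    | _ => 0 end).
Proof.
  destruct i; simpl; auto_derive; trivial; ring.
Qed.

(** Differentiation under the integral.  The radius is the only parameter whose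
    velocity varies, and only near [t] is it required to be differentiable: it
    will be [norm2] of the planar velocity, which is singular at 0. *)
Lemma is_derive_RInt_orbit omega (w : R -> R) u (c1 c2 z r k dr : R -> R) dc1 dc2 dz dk t :
  (forall a, continuous w a) -> smooth u ->
  (forall s, is_derive c1 s dc1) -> (forall s, is_derive c2 s dc2) ->
  (forall s, is_derive z s dz) -> (forall s, is_derive k s dk) ->
  locally t (fun s => is_derive r s (dr s)) -> continuous dr t ->
  is_derive (fun s => RInt (fun a =>
      w a * u (of_coords (orbit omega (c1 s) (c2 s) (z s) (r s) (k s) a))) 0 (2 * PI)) t
    (RInt (fun a => w a * gradient_dot (orbit omega dc1 dc2 dz (dr t) dk a) u
        (of_coords (orbit omega (c1 t) (c2 t) (z t) (r t) (k t) a))) 0 (2 * PI)).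
Proof.
  intros Hw Hu H1 H2 H3 H5 H4 Hdr.
  set (f := fun s a => w a * u (of_coords (orbit omega (c1 s) (c2 s) (z s) (r s) (k s) a))).
  set (df := fun s a => w a * gradient_dot (orbit omega dc1 dc2 dz (dr s) dk a) u
        (of_coords (orbit omega (c1 s) (c2 s) (z s) (r s) (k s) a))).
  assert (Hf : forall s a, is_derive r s (dr s) -> is_derive (fun s => f s a) s (df s a)).
  { intros s a Hr. unfold f, df.
    apply (is_derive_scal (fun s => u (of_coords (orbit omega (c1 s) (c2 s) (z s) (r s) (k s) a)))).
    apply (is_derive_along u (fun s => orbit omega (c1 s) (c2 s) (z s) (r s) (k s) a)); trivial.
    intros i. now apply is_derive_orbit. }
  assert (C : forall (g : R -> R) dg, (forall s, is_derive g s dg) -> forall s, continuous g s).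
  { intros g dg H s. exact (is_derive_continuous _ _ _ (H s)). }
  assert (Cr : continuous r t).
  { exact (is_derive_continuous _ _ _ (locally_singleton _ _ H4)). }
  assert (Cdf : forall a, continuity_2d_pt df t a).
  { intros a. apply continuity_2d_pt_filterlim.
    change (continuous (fun q : R * R => df (fst q) (snd q)) (t, a)).
    assert (Cf : forall g : R -> R, continuous g t ->
       continuous (fun q : R * R => g (fst q)) (t, a)).
    { intros g Hg. apply (continuous_comp fst g); [apply continuous_fst | exact Hg]. }
    assert (Ca := continuous_snd t a).
    assert (Cv : forall i, continuous (fun q : R * R => orbit omega dc1 dc2 dz (dr (fst q)) dk (snd q) i) (t, a)).
    { intros i. apply (continuous_orbit omega (fun _ => dc1) (fun _ => dc2) (fun _ => dz)
        (fun q : R * R => dr (fst q)) (fun _ => dk) snd); trivial; try apply continuous_const. now apply Cf. }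
    apply (continuous_mult (fun q : R * R => w (snd q))).
    { apply (continuous_comp snd w); trivial. }
    apply (continuous_gradient_dot u
      (fun q : R * R => orbit omega dc1 dc2 dz (dr (fst q)) dk (snd q))
      (fun q => orbit omega (c1 (fst q)) (c2 (fst q)) (z (fst q)) (r (fst q))
                      (k (fst q)) (snd q))); trivial.
    intros j. apply (continuous_orbit omega (fun q : R * R => c1 (fst q)) (fun q => c2 (fst q))
      (fun q => z (fst q)) (fun q => r (fst q)) (fun q => k (fst q)) snd);
      trivial; apply Cf; eauto. }
  assert (E : RInt (df t) 0 (2 * PI) = RInt (fun a => Derive (fun s => f s a) t) 0 (2 * PI)).
  { apply RInt_ext. intros a _. symmetry. apply is_derive_unique, Hf. exact (locally_singleton _ _ H4). }
  change (is_derive (fun s => RInt (f s) 0 (2 * PI)) t (RInt (df t) 0 (2 * PI))).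
  rewrite E.
  apply is_derive_RInt_param.
  - revert H4. apply filter_imp. intros s Hs a _. eexists. now apply Hf.
  - intros a _. apply (continuity_2d_pt_ext_loc df); [|apply Cdf].
    apply locally_2d_locally.
    generalize (continuous_fst t a _ H4). unfold filtermap. apply filter_imp.
    intros [s b] Hs. simpl in *. symmetry. now apply is_derive_unique, Hf.
  - apply filter_forall. intros s. apply (ex_RInt_continuous (V := R_CompleteNormedModule)). intros a _.
    apply (continuous_mult w (fun a => u (of_coords (orbit omega (c1 s) (c2 s) (z s) (r s) (k s) a)))); trivial.
    apply (continuous_comp (fun a => of_coords (orbit omega (c1 s) (c2 s) (z s) (r s) (k s) a)) u); [|now apply smooth_continuous].
    apply (continuous_of_coords (fun a => orbit omega (c1 s) (c2 s) (z s) (r s) (k s) a)).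
    intros i. eapply is_derive_continuous, is_derive_orbit_angle.
Qed.

(** * Means over the angle *)

Definition mean (f : R -> R) : R := / (2 * PI) * RInt f 0 (2 * PI).

(** The relational form of [mean]: it includes integrability, so that linear
    combinations of means can be assembled without side conditions. *)
Definition is_mean (f : R -> R) (l : R) : Prop := is_RInt f 0 (2 * PI) (2 * PI * l).

Lemma mean_unique f l : is_mean f l -> mean f = l.
Proof.
  intros H. unfold mean. rewrite (is_RInt_unique _ _ _ _ H).
  field. apply PI_neq0.
Qed.

Lemma is_mean_continuous f : (forall a, continuous f a) -> is_mean f (mean f).
Proof.
  intros H. unfold is_mean, mean.
  rewrite <- Rmult_assoc, Rinv_r, Rmult_1_l.
  - apply (RInt_correct f). apply (ex_RInt_continuous (V := R_CompleteNormedModule)).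
    intros a _; apply H.
  - generalize PI_neq0; lra.
Qed.

Lemma is_mean_ext f g l : (forall a, f a = g a) -> is_mean f l -> is_mean g l.
Proof. intros H. apply is_RInt_ext. intros a _; apply H. Qed.

Lemma is_mean_plus f g l m : is_mean f l -> is_mean g m -> is_mean (fun a => f a + g a) (l + m).
Proof.
  intros Hf Hg. unfold is_mean. rewrite Rmult_plus_distr_l. exact (is_RInt_plus f g _ _ _ _ Hf Hg).
Qed.

Lemma is_mean_minus f g l m : is_mean f l -> is_mean g m -> is_mean (fun a => f a - g a) (l - m).
Proof.
  intros Hf Hg. unfold is_mean. rewrite Rmult_minus_distr_l. exact (is_RInt_minus f g _ _ _ _ Hf Hg).
Qed.

Lemma is_mean_scal c f l : is_mean f l -> is_mean (fun a => f a * c) (l * c).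
Proof.
  intros Hf. unfold is_mean.
  replace (2 * PI * (l * c)) with (scal c (2 * PI * l)) by (unfold scal; simpl; unfold mult; simpl; ring).
  apply (is_RInt_ext (fun a => scal c (f a))).
  - intros a _. unfold scal; simpl; unfold mult; simpl; ring.
  - exact (is_RInt_scal f _ _ c _ Hf).
Qed.

(** A weight is allowed in the average because the components of a field along
    [e_par] and [e_perp] become [cos] and [sin] combinations of its Cartesian
    components on the gyration circle. *)
Definition gyromean omega (w : R -> R) (u : phase -> R) (p : phase) : R :=
  mean (fun a => w a * u (gyro omega a p)).

Lemma avg_gyromean omega u : avg omega u = gyromean omega (fun _ => 1) u.
Proof.
  extensionality p. unfold avg, gyromean, mean. f_equal.
  apply RInt_ext. intros a _. symmetry; apply Rmult_1_l.
Qed.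

Lemma is_mean_gyromean omega w u p : (forall a, continuous w a) -> smooth u ->
  is_mean (fun a => w a * u (gyro omega a p)) (gyromean omega w u p).
Proof.
  intros Hw Hu. apply is_mean_continuous. intros a.
  apply (continuous_mult w); trivial.
  apply (continuous_comp (fun a => gyro omega a p) u); [|now apply smooth_continuous].
  destruct p as [[[x1 x2] x3] [[v1 v2] v3]].
  eapply continuous_ext; [intros b; symmetry; apply gyro_orbit|].
  apply continuous_of_coords. intros i.
  eapply is_derive_continuous, is_derive_orbit_angle.
Qed.

Lemma avg_lin omega u v a b p : smooth u -> smooth v ->
  avg omega (fun q => a * u q + b * v q) p = a * avg omega u p + b * avg omega v p.
Proof.
  intros Hu Hv. rewrite !avg_gyromean.
  assert (C1 : forall a, continuous (fun _ : R => 1) a) by (intros; apply continuous_const).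
  apply mean_unique. rewrite !(Rmult_comm _ (gyromean _ _ _ _)).
  eapply is_mean_ext; [|apply is_mean_plus; apply is_mean_scal; apply is_mean_gyromean; trivial].
  intros c; simpl; ring.
Qed.

Lemma avg_plus omega u v p : smooth u -> smooth v ->
  avg omega (fun q => u q + v q) p = avg omega u p + avg omega v p.
Proof.
  intros Hu Hv.
  replace (fun q => u q + v q) with (fun q => 1 * u q + 1 * v q).
  - rewrite avg_lin by trivial. ring.
  - extensionality q; ring.
Qed.

Lemma avg_0 omega p : avg omega (fun _ => 0) p = 0.
Proof.
  rewrite avg_gyromean. apply mean_unique.
  apply (is_mean_ext (fun _ => 0)); [intros a; ring|].
  unfold is_mean. rewrite Rmult_0_r.
  evar_last; [apply is_RInt_const | apply Rmult_0_r].
Qed.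

(** * Derivatives of gyroaverages *)

Lemma sum_sqr_pos w : w <> (0, 0) -> 0 < fst w ^ 2 + snd w ^ 2.
Proof.
  destruct w as [a b]; simpl. intros H.
  destruct (Req_dec a 0) as [Ha|Ha]; [destruct (Req_dec b 0) as [Hb|Hb]|]; try nra.
  subst; now destruct H.
Qed.

Lemma norm2_neq_0 w : w <> (0, 0) -> norm2 w <> 0.
Proof. intros H. apply Rgt_not_eq, sqrt_lt_R0, sum_sqr_pos, H. Qed.

Lemma norm2_swap a b : norm2 (a, b) = norm2 (b, a).
Proof. unfold norm2; simpl. f_equal; ring. Qed.

Lemma is_derive_norm2_fst a b : 0 < a ^ 2 + b ^ 2 ->
  is_derive (fun s => norm2 (s, b)) a (/ norm2 (a, b) * a).
Proof.
  intros H. unfold norm2; simpl in *. auto_derive; trivial.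
  field. apply Rgt_not_eq, sqrt_lt_R0, H.
Qed.

Lemma C1_norm2_fst a b : 0 < a ^ 2 + b ^ 2 ->
  locally a (fun s => is_derive (fun s => norm2 (s, b)) s (/ norm2 (s, b) * s)) /\
  continuous (fun s => / norm2 (s, b) * s) a.
Proof.
  intros H. split.
  - assert (Cf : continuous (fun s => s ^ 2 + b ^ 2) a).
    { apply (ex_derive_continuous (fun s => s ^ 2 + b ^ 2)). auto_derive; trivial. }
    generalize (Cf _ (open_gt 0 _ H)). unfold filtermap. apply filter_imp.
    intros s Hs. now apply is_derive_norm2_fst.
  - apply (ex_derive_continuous (fun s => / norm2 (s, b) * s)).
    unfold norm2; simpl in *. auto_derive. repeat split; trivial.
    apply Rgt_not_eq, sqrt_lt_R0, H.
Qed.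

(** The velocity of the gyration point of angle [a] when the coordinate [i] of [p]
    has unit speed.  A planar velocity coordinate moves the guiding center by
    [/ omega] in the orthogonal direction and the radius by its component along
    [e_par]. *)
Definition drift omega i (p : phase) (a : R) : coord -> R :=
  match i with
  | X1 => orbit omega 1 0 0 0 0 a
  | X2 => orbit omega 0 1 0 0 0 a
  | X3 => orbit omega 0 0 1 0 0 a
  | V1 => orbit omega 0 (- / omega) 0 (fst (e_par p)) 0 a
  | V2 => orbit omega (/ omega) 0 0 (snd (e_par p)) 0 a
  | V3 => orbit omega 0 0 0 0 1 a
  end.

Definition mean_rate omega (w : R -> R) i u p : R :=
  mean (fun a => w a * gradient_dot (drift omega i p a) u (gyro omega a p)).

Definition moves_radius i := match i with V1 | V2 => True | _ => False end.

(** Only the coordinates [V1] and [V2] meet the singularity of the radius, which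
    is why the other derivatives exist at every [p]. *)
Lemma is_derive_gyromean omega i w u p : (forall a, continuous w a) -> smooth u ->
  (moves_radius i -> bar (snd p) <> (0, 0)) ->
  is_derive (fun s => gyromean omega w u (set i s p)) (get i p)
    (mean_rate omega w i u p).
Proof.
  intros Hw Hu Hi. destruct p as [[[x1 x2] x3] [[v1 v2] v3]].
  unfold gyromean, mean_rate, mean. apply is_derive_scal.
  pose (g := fun i s => fun a => w a * u (gyro omega a (set i s ((x1, x2, x3), (v1, v2, v3))))).
  pose (D := fun i => fun a => w a * gradient_dot (drift omega i ((x1, x2, x3), (v1, v2, v3)) a) u
     (gyro omega a ((x1, x2, x3), (v1, v2, v3)))).
  change (is_derive (fun s => RInt (g i s) 0 (2 * PI)) (get i ((x1, x2, x3), (v1, v2, v3)))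
    (RInt (D i) 0 (2 * PI))).
  assert (Hid : forall c x : R, is_derive (fun s : R => s + c) x 1) by (intros; auto_derive; trivial).
  assert (Hid' : forall x : R, is_derive (fun s : R => s) x 1) by (intros; auto_derive; trivial).
  assert (H0 : forall c x : R, is_derive (fun _ : R => c) x 0) by (intros; auto_derive; trivial).
  assert (Hm : forall c d x : R, is_derive (fun s : R => c + d * s) x d) by (intros; auto_derive; trivial; ring).
  assert (Hm' : forall c d x : R, is_derive (fun s : R => c - d * s) x (- d)) by (intros; auto_derive; trivial; ring).
  assert (key : forall (c1 c2 z r k dr : R -> R) (dc1 dc2 dz dk : R) t,
    (forall s, is_derive c1 s dc1) -> (forall s, is_derive c2 s dc2) ->
    (forall s, is_derive z s dz) -> (forall s, is_derive k s dk) ->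
    locally t (fun s => is_derive r s (dr s)) /\ continuous dr t ->
    (forall s a, g i s a = w a * u (of_coords (orbit omega (c1 s) (c2 s) (z s) (r s) (k s) a))) ->
    (forall a, D i a = w a * gradient_dot (orbit omega dc1 dc2 dz (dr t) dk a) u
       (of_coords (orbit omega (c1 t) (c2 t) (z t) (r t) (k t) a))) ->
    is_derive (fun s => RInt (g i s) 0 (2 * PI)) t (RInt (D i) 0 (2 * PI))).
  { intros c1 c2 z r k dr dc1 dc2 dz dk t E1 E2 E3 E4 [E5 E6] Eg ED.
    rewrite (RInt_ext _ _ _ _ (fun a _ => ED a)).
    apply (is_derive_ext (fun s => RInt (fun a =>
      w a * u (of_coords (orbit omega (c1 s) (c2 s) (z s) (r s) (k s) a))) 0 (2 * PI))).
    - intros s. apply RInt_ext. intros a _. now rewrite Eg.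
    - now apply is_derive_RInt_orbit. }
  assert (Cr : forall t c : R, locally t (fun s : R => is_derive (fun _ : R => c) s 0) /\
    continuous (fun _ : R => 0) t).
  { intros t c; split; [apply filter_forall; intros; apply H0 | apply continuous_const]. }
  destruct i; simpl get.
  - apply (key (fun s => s + / omega * v2) (fun _ => x2 - / omega * v1) (fun _ => x3)
      (fun _ => norm2 (v1, v2)) (fun _ => v3) (fun _ => 0) 1 0 0 0); trivial;
      intros; unfold g, D; simpl set; now rewrite gyro_orbit.
  - apply (key (fun _ => x1 + / omega * v2) (fun s => s - / omega * v1) (fun _ => x3)
      (fun _ => norm2 (v1, v2)) (fun _ => v3) (fun _ => 0) 0 1 0 0); trivial;
      [intros; apply Hid| |]; intros; unfold g, D; simpl set; now rewrite gyro_orbit.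
  - apply (key (fun _ => x1 + / omega * v2) (fun _ => x2 - / omega * v1) (fun s => s)
      (fun _ => norm2 (v1, v2)) (fun _ => v3) (fun _ => 0) 0 0 1 0); trivial;
      intros; unfold g, D; simpl set; now rewrite gyro_orbit.
  - apply (key (fun _ => x1 + / omega * v2) (fun s => x2 - / omega * s) (fun _ => x3)
      (fun s => norm2 (s, v2)) (fun _ => v3) (fun s => / norm2 (s, v2) * s) 0 (- / omega) 0 0); trivial.
    + apply C1_norm2_fst, (sum_sqr_pos (v1, v2)), Hi, I.
    + intros; unfold g, D; simpl set; now rewrite gyro_orbit.
    + intros; unfold g, D; simpl set; now rewrite gyro_orbit.
  - apply (key (fun s => x1 + / omega * s) (fun _ => x2 - / omega * v1) (fun _ => x3)
      (fun s => norm2 (s, v1)) (fun _ => v3) (fun s => / norm2 (s, v1) * s) (/ omega) 0 0 0); trivial.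
    + apply C1_norm2_fst. rewrite Rplus_comm. apply (sum_sqr_pos (v1, v2)), Hi, I.
    + intros; unfold g, D; simpl set; rewrite gyro_orbit. now rewrite (norm2_swap v1).
    + intros; unfold g, D; simpl set; rewrite gyro_orbit.
      unfold drift, e_par; simpl. now rewrite (norm2_swap v1).
  - apply (key (fun _ => x1 + / omega * v2) (fun _ => x2 - / omega * v1) (fun _ => x3)
      (fun _ => norm2 (v1, v2)) (fun s => s) (fun _ => 0) 0 0 0 1); trivial;
      intros; unfold g, D; simpl set; now rewrite gyro_orbit.
Qed.

(** Moving the position or the third velocity translates the whole gyration
    circle rigidly, so these derivatives commute with the average. *)
Lemma is_derive_avg omega i u p : smooth u -> ~ moves_radius i ->
  is_derive (fun s => avg omega u (set i s p)) (get i p) (avg omega (partial i u) p).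
Proof.
  intros Hu Hi. rewrite !avg_gyromean.
  replace (gyromean omega (fun _ => 1) (partial i u) p) with
    (mean_rate omega (fun _ => 1) i u p).
  - apply (is_derive_gyromean omega i (fun _ => 1)); trivial.
    + intros; apply continuous_const.
    + now intros Hi'.
  - unfold gyromean, mean_rate, mean. f_equal. apply RInt_ext. intros a _.
    unfold gradient_dot. destruct i; simpl in *; try (now destruct Hi); ring.
Qed.

Lemma continuous_gyro_gradient omega (w : R -> R) (d : R -> coord -> R) u p a :
  smooth u -> continuous w a -> (forall i, continuous (fun b => d b i) a) ->
  continuous (fun b => w b * gradient_dot (d b) u (gyro omega b p)) a.
Proof.
  intros Hu Hw Hd. apply (continuous_mult w); trivial.
  destruct p as [[[x1 x2] x3] [[v1 v2] v3]].
  eapply continuous_ext; [intros b; rewrite gyro_orbit; reflexivity|].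
  apply (continuous_gradient_dot u); trivial.
  intros i. eapply is_derive_continuous, is_derive_orbit_angle.
Qed.

Lemma is_mean_drift omega w i u p : (forall a, continuous w a) -> smooth u ->
  is_mean (fun a => w a * gradient_dot (drift omega i p a) u (gyro omega a p))
    (mean_rate omega w i u p).
Proof.
  intros Hw Hu. apply is_mean_continuous. intros a.
  apply continuous_gyro_gradient; trivial.
  intros j. destruct i; eapply is_derive_continuous, is_derive_orbit_angle.
Qed.

Definition spin omega (r a : R) (i : coord) : R :=
  r * match i with
      | X1 => - / omega * cos a
      | X2 => - / omega * sin a
      | V1 => - sin a
      | V2 => cos a
      | _ => 0
      end.

(** Integration by parts over the angle: the integrand is the derivative of the
    periodic function [w * u], since [spin] is the velocity of the point running
    along its gyration circle. *)
Lemma is_mean_spin omega (w dw : R -> R) u p :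
  (forall a, is_derive w a (dw a)) -> (forall a, continuous dw a) ->
  w (2 * PI) = w 0 -> smooth u ->
  is_mean (fun a => dw a * u (gyro omega a p)
     + w a * gradient_dot (spin omega (norm2 (bar (snd p))) a) u (gyro omega a p)) 0.
Proof.
  intros Hw Hdw Hper Hu.
  assert (Cw : forall a, continuous w a) by (intros a; exact (is_derive_continuous _ _ _ (Hw a))).
  assert (Cu : forall a, continuous (fun b => u (gyro omega b p)) a).
  { intros a. apply (continuous_comp (fun b => gyro omega b p) u); [|now apply smooth_continuous].
    destruct p as [[[x1 x2] x3] [[v1 v2] v3]].
    eapply continuous_ext; [intros b; symmetry; apply gyro_orbit|].
    apply continuous_of_coords. intros i. eapply is_derive_continuous, is_derive_orbit_angle. }
  assert (Hd : forall a, is_derive (fun b => u (gyro omega b p)) a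
     (gradient_dot (spin omega (norm2 (bar (snd p))) a) u (gyro omega a p))).
  { intros a. destruct p as [[[x1 x2] x3] [[v1 v2] v3]]. rewrite gyro_orbit.
    eapply is_derive_ext; [intros b; rewrite gyro_orbit; reflexivity|].
    apply (is_derive_along u (orbit _ _ _ _ _ _)); trivial.
    intros i. apply is_derive_orbit_angle. }
  unfold is_mean. rewrite Rmult_0_r.
  replace 0 with (minus (w (2 * PI) * u (gyro omega (2 * PI) p)) (w 0 * u (gyro omega 0 p))) at 2.
  - apply (is_RInt_derive (fun a => w a * u (gyro omega a p))).
    + intros a _. apply (is_derive_mult w (fun b => u (gyro omega b p)));
        trivial. intros; apply Rmult_comm.
    + intros a _. apply (continuous_plus (fun a => dw a * u (gyro omega a p))).
      * now apply (continuous_mult dw).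
      * apply continuous_gyro_gradient; trivial.
        intros i. apply (ex_derive_continuous (fun b => spin omega (norm2 (bar (snd p))) b i)).
        destruct i; unfold spin; auto_derive; trivial.
  - rewrite Hper.
    replace (gyro omega (2 * PI) p) with (gyro omega 0 p).
    + apply Rminus_diag_eq; reflexivity.
    + destruct p as [[[x1 x2] x3] [[v1 v2] v3]].
      unfold gyro, circle. now rewrite cos_2PI, sin_2PI, cos_0, sin_0.
Qed.

(** * The rotating frame *)

Lemma gyro_norm2 omega a q : norm2 (bar (snd (gyro omega a q))) = norm2 (bar (snd q)).
Proof.
  destruct q as [x v]. unfold gyro, circle; simpl. unfold norm2 at 1; simpl.
  set (r := norm2 (bar v)).
  replace (r * cos a * (r * cos a * 1) + r * sin a * (r * sin a * 1))
    with (r² * ((sin a)² + (cos a)²)) by (unfold Rsqr; ring).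
  rewrite sin2_cos2, Rmult_1_r. apply sqrt_Rsqr, sqrt_pos.
Qed.

(** Gyration preserves the speed, so on the circle the frame depends on the angle
    alone.  At zero planar velocity [e_par] is 0 and this fails. *)
Lemma e_par_gyro omega a q : bar (snd q) <> (0, 0) ->
  e_par (gyro omega a q) = (cos a, sin a).
Proof.
  intros H. unfold e_par. rewrite gyro_norm2. apply norm2_neq_0 in H.
  destruct q as [x v]; simpl in *. unfold circle, scal; simpl.
  unfold prod_scal, scal; simpl; unfold mult; simpl. f_equal; now field.
Qed.

Lemma e_perp_e_par q : e_perp q = perp (e_par q).
Proof.
  destruct q as [x [[v1 v2] v3]]. unfold e_perp, e_par, perp, scal; simpl.
  unfold prod_scal, scal; simpl; unfold mult; simpl. f_equal; ring.
Qed.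

Lemma e_par_unit p : bar (snd p) <> (0, 0) ->
  fst (e_par p) ^ 2 = 1 - snd (e_par p) ^ 2.
Proof.
  intros H. assert (Hr := norm2_neq_0 _ H). assert (Hs := sum_sqr_pos _ H).
  destruct p as [x [[v1 v2] v3]]. unfold e_par, scal; simpl in *.
  unfold prod_scal, scal; simpl; unfold mult; simpl.
  assert (E : norm2 (v1, v2) * norm2 (v1, v2) = v1 ^ 2 + v2 ^ 2) by (apply sqrt_sqrt, Rlt_le; exact Hs).
  set (r := norm2 (v1, v2)) in *.
  assert (v1 ^ 2 = r * r - v2 ^ 2) by lra.
  transitivity (/ r ^ 2 * (v1 ^ 2)); [field; trivial|]. rewrite H0. field; trivial.
Qed.

Lemma is_derive_unit_fst a b : 0 < a ^ 2 + b ^ 2 ->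
  is_derive (fun s => / norm2 (s, b) * s) a (/ norm2 (a, b) * (/ norm2 (a, b) * b) ^ 2) /\
  is_derive (fun s => / norm2 (s, b) * b) a
    (- (/ norm2 (a, b) * ((/ norm2 (a, b) * a) * (/ norm2 (a, b) * b)))).
Proof.
  intros H. assert (Hr := sqrt_lt_R0 _ H). assert (E := sqrt_sqrt _ (Rlt_le _ _ H)).
  assert (Hi : is_derive (fun s => / norm2 (s, b)) a (- (/ norm2 (a, b) * a) / norm2 (a, b) ^ 2)).
  { apply is_derive_inv; [now apply is_derive_norm2_fst | exact (Rgt_not_eq _ _ Hr)]. }
  change (sqrt (a ^ 2 + b ^ 2)) with (norm2 (a, b)) in *.
  set (r := norm2 (a, b)) in *.
  assert (E' : b ^ 2 = r * r - a ^ 2) by lra.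
  split.
  - replace (/ r * (/ r * b) ^ 2) with (- (/ r * a) / r ^ 2 * a + / r * 1).
    2:{ transitivity (/ r * (/ r) ^ 2 * b ^ 2); [|ring]. rewrite E'. field. lra. }
    apply (is_derive_mult (fun s => / norm2 (s, b)) (fun s => s) a); trivial.
    + apply (is_derive_id a).
    + intros; apply Rmult_comm.
  - replace (- (/ r * (/ r * a * (/ r * b)))) with (- (/ r * a) / r ^ 2 * b + / r * 0).
    2:{ field. lra. }
    apply (is_derive_mult (fun s => / norm2 (s, b)) (fun _ => b) a); trivial.
    + apply (is_derive_const b a).
    + intros; apply Rmult_comm.
Qed.

Lemma is_derive_e_par_V1 p : bar (snd p) <> (0, 0) ->
  is_derive (fun s => fst (e_par (set V1 s p))) (get V1 p)
    (/ norm2 (bar (snd p)) * snd (e_par p) ^ 2) /\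
  is_derive (fun s => snd (e_par (set V1 s p))) (get V1 p)
    (- (/ norm2 (bar (snd p)) * (fst (e_par p) * snd (e_par p)))).
Proof.
  intros Hp. destruct p as [[[x1 x2] x3] [[v1 v2] v3]].
  exact (is_derive_unit_fst v1 v2 (sum_sqr_pos _ Hp)).
Qed.

Lemma is_derive_e_par_V2 p : bar (snd p) <> (0, 0) ->
  is_derive (fun s => fst (e_par (set V2 s p))) (get V2 p)
    (- (/ norm2 (bar (snd p)) * (fst (e_par p) * snd (e_par p)))) /\
  is_derive (fun s => snd (e_par (set V2 s p))) (get V2 p)
    (/ norm2 (bar (snd p)) * fst (e_par p) ^ 2).
Proof.
  intros Hp. assert (Hs := sum_sqr_pos _ Hp).
  destruct p as [[[x1 x2] x3] [[v1 v2] v3]].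
  rewrite Rplus_comm in Hs. destruct (is_derive_unit_fst v2 v1 Hs) as [H1 H2].
  rewrite (Rmult_comm (fst _) (snd _)).
  unfold e_par; simpl. rewrite (norm2_swap v1).
  split; [apply (is_derive_ext (fun s => / norm2 (s, v1) * v1)) |
          apply (is_derive_ext (fun s => / norm2 (s, v1) * s))]; trivial;
    intros s; now rewrite norm2_swap.
Qed.

Definition smooth2 (F : phase -> R2) : Prop :=
  smooth (fun q => fst (F q)) /\ smooth (fun q => snd (F q)).

Definition par_mean omega (W : phase -> R2) (q : phase) : R :=
  gyromean omega cos (fun q => fst (W q)) q + gyromean omega sin (fun q => snd (W q)) q.

Definition perp_mean omega (W : phase -> R2) (q : phase) : R :=
  gyromean omega sin (fun q => fst (W q)) q - gyromean omega cos (fun q => snd (W q)) q.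

Lemma avg_par omega W q : smooth2 W -> bar (snd q) <> (0, 0) ->
  avg omega (fun q' => dot2 (W q') (e_par q')) q = par_mean omega W q.
Proof.
  intros [HW1 HW2] H. apply mean_unique.
  eapply is_mean_ext; [|apply is_mean_plus; apply is_mean_gyromean; trivial].
  - intros a. unfold dot2. rewrite e_par_gyro by trivial. simpl. ring.
  - intros; apply continuous_cos.
  - intros; apply continuous_sin.
Qed.

Lemma avg_perp omega W q : smooth2 W -> bar (snd q) <> (0, 0) ->
  avg omega (fun q' => dot2 (W q') (e_perp q')) q = perp_mean omega W q.
Proof.
  intros [HW1 HW2] H. apply mean_unique.
  eapply is_mean_ext; [|apply is_mean_minus; apply is_mean_gyromean; trivial].
  - intros a. unfold dot2. rewrite e_perp_e_par, e_par_gyro by trivial. simpl. ring.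
  - intros; apply continuous_sin.
  - intros; apply continuous_cos.
Qed.

Definition par_rate omega (W : phase -> R2) i p :=
  mean_rate omega cos i (fun q => fst (W q)) p
  + mean_rate omega sin i (fun q => snd (W q)) p.
Definition perp_rate omega (W : phase -> R2) i p :=
  mean_rate omega sin i (fun q => fst (W q)) p
  - mean_rate omega cos i (fun q => snd (W q)) p.

Lemma bar_set_neq_0 i p : bar (snd p) <> (0, 0) ->
  locally (get i p) (fun s => bar (snd (set i s p)) <> (0, 0)).
Proof.
  intros H. set (f := fun s => fst (bar (snd (set i s p))) ^ 2 + snd (bar (snd (set i s p))) ^ 2).
  assert (Hf : 0 < f (get i p)).
  { replace (f (get i p)) with (fst (bar (snd p)) ^ 2 + snd (bar (snd p)) ^ 2).
    - now apply sum_sqr_pos.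
    - destruct p as [[[x1 x2] x3] [[v1 v2] v3]]; now destruct i. }
  assert (Cf : continuous f (get i p)).
  { apply (ex_derive_continuous f).
    destruct p as [[[x1 x2] x3] [[v1 v2] v3]]; destruct i; unfold f; simpl; auto_derive; trivial. }
  generalize (Cf _ (open_gt 0 _ Hf)). unfold filtermap. apply filter_imp.
  intros s Hs E. unfold f in Hs. rewrite E in Hs. simpl in Hs. lra.
Qed.

(** The [cos]/[sin] expression of the mean is available only off zero planar
    velocity, but this is an open condition along each coordinate line. *)
Lemma is_derive_avg_par omega W i p : smooth2 W -> bar (snd p) <> (0, 0) ->
  is_derive (fun s => avg omega (fun q' => dot2 (W q') (e_par q')) (set i s p)) (get i p) (par_rate omega W i p).
Proof.
  intros [HW1 HW2] H. apply (is_derive_ext_loc (fun s => par_mean omega W (set i s p))).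
  { generalize (bar_set_neq_0 i p H). apply filter_imp. intros s Hs. symmetry; now apply avg_par. }
  apply (is_derive_plus (fun s => gyromean omega cos (fun q => fst (W q)) (set i s p))).
  - apply is_derive_gyromean; trivial. intros; apply continuous_cos.
  - apply is_derive_gyromean; trivial. intros; apply continuous_sin.
Qed.

Lemma is_derive_avg_perp omega W i p : smooth2 W -> bar (snd p) <> (0, 0) ->
  is_derive (fun s => avg omega (fun q' => dot2 (W q') (e_perp q')) (set i s p)) (get i p) (perp_rate omega W i p).
Proof.
  intros [HW1 HW2] H. apply (is_derive_ext_loc (fun s => perp_mean omega W (set i s p))).
  { generalize (bar_set_neq_0 i p H). apply filter_imp. intros s Hs. symmetry; now apply avg_perp. }
  apply (is_derive_minus (fun s => gyromean omega sin (fun q => fst (W q)) (set i s p))).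
  - apply is_derive_gyromean; trivial. intros; apply continuous_sin.
  - apply is_derive_gyromean; trivial. intros; apply continuous_cos.
Qed.

(** * Divergence of the fluxes *)

(** The heart of the computation, for one Cartesian component [u] of the field.
    Its component along the rotating radial direction carries the weight [w],
    and the one along [e_perp] the weight [- w'] ([w = cos] for the first
    component, [w = sin] for the second).  The right-hand side is what the flux
    divergences produce from [u]: derivatives along the frame [(e1, e2)] at the
    base point, and the curvature term in [1/r].  The derivatives of the guiding
    center cancel between the position and velocity fluxes, leaving the radial
    derivative; the curvature term is turned into an angular derivative by
    [is_mean_spin]; the two recombine into Cartesian derivatives in the rotated
    frame, as for the divergence in polar coordinates.  The terms in [/ omega]
    appear since the circle in position space turns along with the velocity. *)
Lemma is_mean_polar_divergence omega (w w' : R -> R) u p :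
  smooth u -> bar (snd p) <> (0, 0) ->
  (forall a, is_derive w a (w' a)) -> (forall a, is_derive w' a (- w a)) ->
  w' (2 * PI) = w' 0 ->
  let e1 := fst (e_par p) in let e2 := snd (e_par p) in
  is_mean (fun a =>
      (w a * cos a - w' a * sin a)
        * (partial V1 u (gyro omega a p) + / omega * partial X2 u (gyro omega a p))
    + (w a * sin a + w' a * cos a)
        * (partial V2 u (gyro omega a p) - / omega * partial X1 u (gyro omega a p)))
    (mean_rate omega w X2 u p * (/ omega * e1) - mean_rate omega w X1 u p * (/ omega * e2)
     - (mean_rate omega w' X1 u p * (/ omega * e1) + mean_rate omega w' X2 u p * (/ omega * e2))
     + (mean_rate omega w V1 u p * e1 + mean_rate omega w V2 u p * e2)
     - (mean_rate omega w' V1 u p * e2 - mean_rate omega w' V2 u p * e1)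
     + gyromean omega w u p * / norm2 (bar (snd p))).
Proof.
  intros Hu Hp Hw Hw' Hper e1 e2.
  assert (Cw : forall a, continuous w a) by (intros a; exact (is_derive_continuous _ _ _ (Hw a))).
  assert (Cw' : forall a, continuous w' a) by (intros a; exact (is_derive_continuous _ _ _ (Hw' a))).
  assert (Cw'' : forall a, continuous (fun b => - w b) a) by (intros a; apply (continuous_opp w); trivial).
  assert (Hr := norm2_neq_0 _ Hp). assert (He := e_par_unit p Hp).
  fold e1 e2 in He.
  (* The integration by parts enters as a mean equal to 0, added to the right-hand
     side; its undifferentiated part cancels the term in 1/r. *)
  assert (Hs := is_mean_spin omega w' (fun a => - w a) u p Hw' Cw'' Hper Hu).
  apply (is_mean_scal (/ norm2 (bar (snd p)))) in Hs. rewrite Rmult_0_l in Hs.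
  rewrite <- Rplus_0_r.
  eapply is_mean_ext.
  2:{ apply is_mean_plus; [|exact Hs].
      repeat match goal with
        | |- is_mean _ (_ + _) => apply is_mean_plus
        | |- is_mean _ (_ - _) => apply is_mean_minus
        | |- is_mean _ (_ * _) => apply is_mean_scal
        | |- is_mean _ (mean_rate _ _ _ _ _) => now apply is_mean_drift
        | |- is_mean _ (gyromean _ _ _ _) => now apply is_mean_gyromean
        end. }
  intros a. unfold gradient_dot, spin. cbn [drift orbit]. fold e1 e2.
  set (r := norm2 (bar (snd p))) in *.
  generalize (partial X1 u (gyro omega a p)), (partial X2 u (gyro omega a p)),
    (partial X3 u (gyro omega a p)), (partial V1 u (gyro omega a p)),
    (partial V2 u (gyro omega a p)), (partial V3 u (gyro omega a p)),
    (u (gyro omega a p)).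
  intros U1 U2 U3 U4 U5 U6 U.
  (* The radial drifts project on the frame and leave the factor e1^2 + e2^2;
     the remaining terms in [w'] come from the rotation, whose speed r cancels
     the factor 1/r. *)
  transitivity
    ((e1 ^ 2 + e2 ^ 2) * (w a * (cos a * (U4 + / omega * U2) + sin a * (U5 - / omega * U1)))
     + (r * / r) * (w' a * (cos a * (U5 - / omega * U1) - sin a * (U4 + / omega * U2)))).
  - ring.
  - rewrite He, Rinv_r by trivial. ring.
Qed.

(** Every component of both fluxes is, up to an average without frame, of this
    shape; the functions [f] and [g] are multiples of the entries of the frame. *)
Lemma is_derive_frame_combination omega W i (f g : R -> R) f' g' p :
  smooth2 W -> bar (snd p) <> (0, 0) ->
  is_derive f (get i p) f' -> is_derive g (get i p) g' ->
  is_derive (fun s =>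
      avg omega (fun q => dot2 (W q) (e_perp q)) (set i s p) * f s
      + avg omega (fun q => dot2 (W q) (e_par q)) (set i s p) * g s) (get i p)
    (perp_rate omega W i p * f (get i p) + perp_mean omega W p * f'
     + (par_rate omega W i p * g (get i p) + par_mean omega W p * g')).
Proof.
  intros HW Hp Hf Hg.
  rewrite <- avg_par, <- avg_perp by trivial.
  evar_last.
  - apply (is_derive_plus (fun s => avg omega (fun q => dot2 (W q) (e_perp q)) (set i s p) * f s)
      (fun s => avg omega (fun q => dot2 (W q) (e_par q)) (set i s p) * g s));
      apply is_derive_Rmult; try eassumption.
    + now apply is_derive_avg_perp.
    + now apply is_derive_avg_par.
  - cbv beta. now rewrite set_get.
Qed.

Lemma flux_xbar_eq omega G W q :
  let a := avg omega (fun q' => dot2 (W q') (e_par q')) q in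
  let b := avg omega (fun q' => dot2 (W q') (e_perp q')) q in
  flux_xbar omega G W q =
  (avg omega (fun q' => fst (G q')) q
   + (b * (/ omega * fst (e_par q)) + a * - (/ omega * snd (e_par q))),
   avg omega (fun q' => snd (G q')) q
   + (b * (/ omega * snd (e_par q)) + a * (/ omega * fst (e_par q)))).
Proof.
  intros a b. unfold flux_xbar. fold a b. rewrite e_perp_e_par.
  clearbody a b. destruct (e_par q) as [e1 e2]. unfold avg2, perp.
  unfold minus, plus, opp, scal; simpl.
  unfold prod_plus, prod_opp, prod_scal, plus, opp, scal; simpl; unfold mult; simpl.
  apply injective_projections; simpl; ring.
Qed.

Lemma flux_vbar_eq omega W q :
  let a := avg omega (fun q' => dot2 (W q') (e_par q')) q in
  let b := avg omega (fun q' => dot2 (W q') (e_perp q')) q in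
  flux_vbar omega W q =
  (b * snd (e_par q) + a * fst (e_par q), b * - fst (e_par q) + a * snd (e_par q)).
Proof.
  intros a b. unfold flux_vbar. fold a b. rewrite e_perp_e_par. reflexivity.
Qed.

Lemma is_derive_flux_xbar omega G W p : smooth2 G -> smooth2 W -> bar (snd p) <> (0, 0) ->
  let e1 := fst (e_par p) in let e2 := snd (e_par p) in
  is_derive (fun s => fst (flux_xbar omega G W (set X1 s p))) (get X1 p)
    (avg omega (partial X1 (fun q => fst (G q))) p
     + (perp_rate omega W X1 p * (/ omega * e1) + par_rate omega W X1 p * - (/ omega * e2))) /\
  is_derive (fun s => snd (flux_xbar omega G W (set X2 s p))) (get X2 p)
    (avg omega (partial X2 (fun q => snd (G q))) p
     + (perp_rate omega W X2 p * (/ omega * e2) + par_rate omega W X2 p * (/ omega * e1))).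
Proof.
  intros [HG1 HG2] HW Hp e1 e2.
  assert (fixed : forall i s, ~ moves_radius i -> e_par (set i s p) = e_par p).
  { intros i s Hi. destruct p as [[[x1 x2] x3] [[v1 v2] v3]].
    destruct i; trivial; now destruct Hi. }
  assert (cst : forall c x : R, is_derive (fun _ : R => c) x 0) by (intros; auto_derive; trivial).
  split.
  - apply (is_derive_ext (fun s => avg omega (fun q => fst (G q)) (set X1 s p)
      + (avg omega (fun q => dot2 (W q) (e_perp q)) (set X1 s p) * (/ omega * e1)
         + avg omega (fun q => dot2 (W q) (e_par q)) (set X1 s p) * - (/ omega * e2)))).
    { intros s. rewrite flux_xbar_eq, fixed by exact (fun h => h). reflexivity. }
    apply (is_derive_plus (fun s => avg omega (fun q => fst (G q)) (set X1 s p))).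
    + apply is_derive_avg; [trivial | exact (fun h => h)].
    + evar_last.
      * now apply (is_derive_frame_combination omega W X1
          (fun _ => / omega * e1) (fun _ => - (/ omega * e2)) 0 0 p HW Hp).
      * simpl; ring.
  - apply (is_derive_ext (fun s => avg omega (fun q => snd (G q)) (set X2 s p)
      + (avg omega (fun q => dot2 (W q) (e_perp q)) (set X2 s p) * (/ omega * e2)
         + avg omega (fun q => dot2 (W q) (e_par q)) (set X2 s p) * (/ omega * e1)))).
    { intros s. rewrite flux_xbar_eq, fixed by exact (fun h => h). reflexivity. }
    apply (is_derive_plus (fun s => avg omega (fun q => snd (G q)) (set X2 s p))).
    + apply is_derive_avg; [trivial | exact (fun h => h)].
    + evar_last.
      * now apply (is_derive_frame_combination omega W X2
          (fun _ => / omega * e2) (fun _ => / omega * e1) 0 0 p HW Hp).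
      * simpl; ring.
Qed.

Lemma is_derive_flux_vbar omega W p : smooth2 W -> bar (snd p) <> (0, 0) ->
  let e1 := fst (e_par p) in let e2 := snd (e_par p) in
  let r := norm2 (bar (snd p)) in
  is_derive (fun s => fst (flux_vbar omega W (set V1 s p))) (get V1 p)
    (perp_rate omega W V1 p * e2 + perp_mean omega W p * - (/ r * (e1 * e2))
     + (par_rate omega W V1 p * e1 + par_mean omega W p * (/ r * e2 ^ 2))) /\
  is_derive (fun s => snd (flux_vbar omega W (set V2 s p))) (get V2 p)
    (perp_rate omega W V2 p * - e1 + perp_mean omega W p * - - (/ r * (e1 * e2))
     + (par_rate omega W V2 p * e2 + par_mean omega W p * (/ r * e1 ^ 2))).
Proof.
  intros HW Hp e1 e2 r.
  destruct (is_derive_e_par_V1 p Hp) as [H11 H12].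
  destruct (is_derive_e_par_V2 p Hp) as [H21 H22].
  split.
  - apply (is_derive_ext (fun s =>
      avg omega (fun q => dot2 (W q) (e_perp q)) (set V1 s p) * snd (e_par (set V1 s p))
      + avg omega (fun q => dot2 (W q) (e_par q)) (set V1 s p) * fst (e_par (set V1 s p)))).
    { intros s. now rewrite flux_vbar_eq. }
    assert (H := is_derive_frame_combination omega W V1 _ _ _ _ p HW Hp H12 H11).
    cbv beta in H. rewrite set_get in H. exact H.
  - apply (is_derive_ext (fun s =>
      avg omega (fun q => dot2 (W q) (e_perp q)) (set V2 s p) * - fst (e_par (set V2 s p))
      + avg omega (fun q => dot2 (W q) (e_par q)) (set V2 s p) * snd (e_par (set V2 s p)))).
    { intros s. now rewrite flux_vbar_eq. }
    assert (H := is_derive_frame_combination omega W V2 _ _ _ _ p HW Hp (is_derive_opp _ _ _ H21) H22).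
    cbv beta in H. rewrite set_get in H. exact H.
Qed.

(** The last line is minus the averaged divergence in position of
    [scal (/ omega) (perp W)]: adding that field to [G] removes it. *)
Lemma flux_divergence omega G W p : smooth2 G -> smooth2 W -> bar (snd p) <> (0, 0) ->
  (ex_div_xbar (flux_xbar omega G W) p /\ ex_div_vbar (flux_vbar omega W) p) /\
  div_xbar (flux_xbar omega G W) p + div_vbar (flux_vbar omega W) p =
    avg omega (partial X1 (fun q => fst (G q))) p
    + avg omega (partial X2 (fun q => snd (G q))) p
    + avg omega (partial V1 (fun q => fst (W q))) p
    + avg omega (partial V2 (fun q => snd (W q))) p
    + / omega * (avg omega (partial X2 (fun q => fst (W q))) p
                 - avg omega (partial X1 (fun q => snd (W q))) p).
Proof.
  intros HG HW Hp.
  destruct (is_derive_flux_xbar omega G W p HG HW Hp) as [D1 D2].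
  destruct (is_derive_flux_vbar omega W p HW Hp) as [D3 D4].
  split.
  { repeat split; eexists; eassumption. }
  unfold div_xbar, div_vbar.
  rewrite (partial_unique X1 (fun q => fst (flux_xbar omega G W q)) _ _ D1),
    (partial_unique X2 (fun q => snd (flux_xbar omega G W q)) _ _ D2),
    (partial_unique V1 (fun q => fst (flux_vbar omega W q)) _ _ D3),
    (partial_unique V2 (fun q => snd (flux_vbar omega W q)) _ _ D4).
  destruct HW as [HW1 HW2].
  assert (dcos : forall a, is_derive cos a (- sin a)) by (intros; auto_derive; trivial; ring).
  assert (dsin : forall a, is_derive sin a (cos a)) by (intros; auto_derive; trivial; ring).
  assert (dnsin : forall a, is_derive (fun b => - sin b) a (- cos a)) by (intros; auto_derive; trivial; ring).
  assert (M1 := is_mean_polar_divergence omega cos (fun a => - sin a) _ p HW1 Hp dcos dnsin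
    ltac:(cbv beta; now rewrite sin_2PI, sin_0)).
  assert (M2 := is_mean_polar_divergence omega sin cos _ p HW2 Hp dsin dcos
    ltac:(cbv beta; now rewrite cos_2PI, cos_0)).
  cbv zeta in M1, M2.
  assert (opp_mean_rate : forall i, mean_rate omega (fun a => - sin a) i (fun q => fst (W q)) p
     = - mean_rate omega sin i (fun q => fst (W q)) p).
  { intros i. apply mean_unique.
    replace (- _) with (mean_rate omega sin i (fun q => fst (W q)) p * -1) by ring.
    eapply is_mean_ext; [|apply is_mean_scal, is_mean_drift; trivial; intros; apply continuous_sin].
    intros a; simpl; ring. }
  rewrite !opp_mean_rate in M1.
  assert (one : forall a, continuous (fun _ : R => 1) a) by (intros; apply continuous_const).
  assert (A1 : forall u i j, smooth u -> forall c,
    is_mean (fun a => partial i u (gyro omega a p) + c * partial j u (gyro omega a p))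
      (avg omega (partial i u) p + c * avg omega (partial j u) p)).
  { intros u i j Hu c. rewrite !avg_gyromean. rewrite (Rmult_comm c).
    eapply is_mean_ext; [|apply is_mean_plus; [|apply is_mean_scal];
      apply is_mean_gyromean; trivial; now apply smooth_partial].
    intros a; simpl; ring. }
  match type of M1 with is_mean _ ?l => assert (E1 : avg omega (partial V1 (fun q => fst (W q))) p
      + / omega * avg omega (partial X2 (fun q => fst (W q))) p = l) end.
  { rewrite <- (mean_unique _ _ (A1 _ V1 X2 HW1 (/ omega))). apply mean_unique.
    eapply is_mean_ext; [|exact M1].
    intros a. assert (C := sin2_cos2 a). unfold Rsqr in C. simpl.
    replace (cos a * cos a - - sin a * sin a) with 1 by lra. ring. }
  match type of M2 with is_mean _ ?l => assert (E2 : avg omega (partial V2 (fun q => snd (W q))) p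
      + - / omega * avg omega (partial X1 (fun q => snd (W q))) p = l) end.
  { rewrite <- (mean_unique _ _ (A1 _ V2 X1 HW2 (- / omega))). apply mean_unique.
    eapply is_mean_ext; [|exact M2].
    intros a. assert (C := sin2_cos2 a). unfold Rsqr in C. simpl.
    replace (sin a * sin a + cos a * cos a) with 1 by lra. ring. }
  (* What is left: the coefficients of the mean of [W] along [e_par] add up to
     (e1^2 + e2^2) / r = 1/r, and those of the mean along [e_perp] cancel. *)
  assert (He := e_par_unit p Hp).
  transitivity (avg omega (partial X1 (fun q => fst (G q))) p
    + avg omega (partial X2 (fun q => snd (G q))) p
    + (avg omega (partial V1 (fun q => fst (W q))) p
      + / omega * avg omega (partial X2 (fun q => fst (W q))) p)
    + (avg omega (partial V2 (fun q => snd (W q))) p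
      + - / omega * avg omega (partial X1 (fun q => snd (W q))) p)); [|ring].
  rewrite E1, E2, He. unfold par_rate, perp_rate, par_mean. ring.
Qed.

Lemma avg_div_x omega (F : phase -> R3) p : smooth3 F ->
  ex_div_x (avg3 omega F) p /\ avg omega (div_x F) p = div_x (avg3 omega F) p.
Proof.
  intros (H1 & H2 & H3).
  assert (D1 := is_derive_avg omega X1 _ p H1 (fun h => h)).
  assert (D2 := is_derive_avg omega X2 _ p H2 (fun h => h)).
  assert (D3 := is_derive_avg omega X3 _ p H3 (fun h => h)).
  split; [repeat split; eexists; eassumption|].
  transitivity (avg omega (partial X1 (fun q => fst (fst (F q)))) p
    + avg omega (partial X2 (fun q => snd (fst (F q)))) p
    + avg omega (partial X3 (fun q => snd (F q))) p).
  - unfold div_x. now rewrite !avg_plus by (try apply smooth_plus; now apply smooth_partial).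
  - symmetry. unfold div_x, avg3; cbn [fst snd].
    f_equal; [f_equal|]; apply partial_unique; assumption.
Qed.

Lemma avg_div_xv omega (xi : phase -> R3 * R3) : smooth6 xi ->
  let xi_xbar := fun q => bar (fst (xi q)) in
  let xi_x3 := fun q => third (fst (xi q)) in
  let xi_vbar := fun q => bar (snd (xi q)) in
  let xi_v3 := fun q => third (snd (xi q)) in
  let Fx := flux_xbar omega
    (fun q => plus (xi_xbar q) (scal (/ omega) (perp (xi_vbar q)))) xi_vbar in
  let Fv := flux_vbar omega xi_vbar in
  forall p : phase, bar (snd p) <> (0, 0) ->
    (ex_div_xbar Fx p /\ ex_partial X3 (avg omega xi_x3) p /\
     ex_div_vbar Fv p /\ ex_partial V3 (avg omega xi_v3) p) /\
    avg omega (div_xv xi) p =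
      div_xbar Fx p + partial X3 (avg omega xi_x3) p
      + div_vbar Fv p + partial V3 (avg omega xi_v3) p.
Proof.
  intros ((Hx1 & Hx2 & Hx3) & (Hv1 & Hv2 & Hv3)) xi_xbar xi_x3 xi_vbar xi_v3 Fx Fv p Hp.
  assert (D3 := is_derive_avg omega X3 xi_x3 p Hx3 (fun h => h)).
  assert (D6 := is_derive_avg omega V3 xi_v3 p Hv3 (fun h => h)).
  set (G := (fun q => plus (xi_xbar q) (scal (/ omega) (perp (xi_vbar q)))) : phase -> R2).
  assert (EG1 : (fun q => fst (G q)) =
    (fun q => 1 * fst (xi_xbar q) + / omega * snd (xi_vbar q))).
  { extensionality q. unfold G. simpl. unfold plus, scal; simpl; unfold mult; simpl. ring. }
  assert (EG2 : (fun q => snd (G q)) =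
    (fun q => 1 * snd (xi_xbar q) + - / omega * fst (xi_vbar q))).
  { extensionality q. unfold G. simpl. unfold plus, scal; simpl; unfold mult; simpl. ring. }
  assert (HG : smooth2 G).
  { split; [rewrite EG1 | rewrite EG2]; now apply smooth_lin. }
  destruct (flux_divergence omega G xi_vbar p HG (conj Hv1 Hv2) Hp) as [[Ex Ev] E].
  change (flux_xbar omega G xi_vbar) with Fx in *. fold Fv in Ev, E.
  split; [now repeat split; try apply Ex; try apply Ev; eexists; eassumption|].
  rewrite EG1, EG2, !partial_lin, !avg_lin in E by (trivial; now apply smooth_partial).
  rewrite (partial_unique X3 _ _ _ D3), (partial_unique V3 _ _ _ D6).
  transitivity (div_xbar Fx p + div_vbar Fv p + avg omega (partial X3 xi_x3) p
    + avg omega (partial V3 xi_v3) p); [rewrite E | ring].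
  unfold div_xv, div_x, div_v.
  rewrite !avg_plus by (repeat apply smooth_plus; now apply smooth_partial).
  unfold xi_x3, xi_v3, xi_xbar, xi_vbar, third, bar. ring.
Qed.

Theorem proposition3p3 (omega : R) (Homega : omega <> 0) :
  (forall (xi : phase -> R3 * R3), smooth6 xi ->
     let xi_xbar := fun q => bar (fst (xi q)) in
     let xi_x3 := fun q => third (fst (xi q)) in
     let xi_vbar := fun q => bar (snd (xi q)) in
     let xi_v3 := fun q => third (snd (xi q)) in
     let Fx := flux_xbar omega
       (fun q => plus (xi_xbar q) (scal (/ omega) (perp (xi_vbar q))))
       xi_vbar in
     let Fv := flux_vbar omega xi_vbar in
     forall p : phase, bar (snd p) <> (0, 0) ->
       (ex_div_xbar Fx p /\ ex_partial X3 (avg omega xi_x3) p /\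
        ex_div_vbar Fv p /\ ex_partial V3 (avg omega xi_v3) p) /\
       avg omega (div_xv xi) p =
         div_xbar Fx p + partial X3 (avg omega xi_x3) p
         + div_vbar Fv p + partial V3 (avg omega xi_v3) p)
  /\
  (forall (xi_x : phase -> R3), smooth3 xi_x ->
     forall p : phase,
       ex_div_x (avg3 omega xi_x) p /\
       avg omega (div_x xi_x) p = div_x (avg3 omega xi_x) p)
  /\
  (forall (xi_v : phase -> R3), smooth3 xi_v ->
     let xi_vbar := fun q => bar (xi_v q) in
     let xi_v3 := fun q => third (xi_v q) in
     let Fx := flux_xbar omega
       (fun q => scal (/ omega) (perp (xi_vbar q))) xi_vbar in
     let Fv := flux_vbar omega xi_vbar in
     forall p : phase, bar (snd p) <> (0, 0) ->
       (ex_div_xbar Fx p /\ ex_div_vbar Fv p /\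
        ex_partial V3 (avg omega xi_v3) p) /\
       avg omega (div_v xi_v) p =
         div_xbar Fx p + div_vbar Fv p + partial V3 (avg omega xi_v3) p).
Proof.
  split; [|split].
  - exact (avg_div_xv omega).
  - intros xi_x Hx p. now apply avg_div_x.
  - intros xi_v Hv xi_vbar xi_v3 Fx Fv p Hp.
    (* The identity for [xi_v] is the full one for the field (0, xi_v). *)
    pose (xi := fun q => ((0, 0, 0), xi_v q) : R3 * R3).
    assert (Hxi : smooth6 xi).
    { split; [repeat split; apply (smooth_const 0) | exact Hv]. }
    destruct (avg_div_xv omega xi Hxi p Hp) as [(Ex & _ & Ev & E3) E].
    replace (fun q => plus (bar (fst (xi q))) (scal (/ omega) (perp (bar (snd (xi q))))))
      with (fun q => scal (/ omega) (perp (xi_vbar q))) in Ex, E.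
    2:{ extensionality q. symmetry. apply (plus_zero_l (scal (/ omega) (perp (xi_vbar q)))). }
    split; [exact (conj Ex (conj Ev E3))|].
    replace (avg omega (div_v xi_v)) with (avg omega (div_xv xi)).
    2:{ f_equal. extensionality q. unfold div_xv, div_x, xi; cbn [fst snd].
        rewrite !partial_const. change (0 + 0 + 0 + div_v xi_v q = div_v xi_v q). ring. }
    rewrite E.
    replace (partial X3 _ p) with 0; [now rewrite Rplus_0_r|].
    symmetry. unfold xi; cbn [fst snd third].
    replace (avg omega (fun _ : phase => 0)) with (fun _ : phase => 0).
    + now rewrite partial_const.
    + extensionality q. symmetry. apply avg_0.
Qed.
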